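(* Let $\mathcal{A}$ and $\mathcal{B}$ be additive induced-hereditary graph properties. Then there is a polynomial-time transformation (many-one reduction) from the $\mathcal{A}$-recognition problem to the $(\mathcal{A}\circ\mathcal{B})$-recognition problem.
   Context: All graphs are simple and finite. A graph property is a set of graphs closed under isomorphism; every property considered here contains the null graph $K_0$ and contains at least one, but not all, finite simple non-null graphs. A property is additive if it is closed under vertex-disjoint unions, and induced-hereditary if it is closed under taking induced subgraphs. For properties $\mathcal{P},\mathcal{Q}$, a $(\mathcal{P},\mathcal{Q})$-colouring of a graph $G$ is a partition $V(G)=A\cup B$ with $G[A]\in\mathcal{P}$ and $G[B]\in\mathcal{Q}$; the product $\mathcal{P}\circ\mathcal{Q}$ is the set of graphs admitting a $(\mathcal{P},\mathcal{Q})$-colouring. The $\mathcal{P}$-recognition problem asks, given a graph $G$, whether $G\in\mathcal{P}$. *)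

(* Defs.v *)
From mathcomp Require Import all_boot.

Set Implicit Arguments.
Unset Strict Implicit.
Unset Printing Implicit Defensive.

Record sgraph := SGraph {
  vertex :> finType;
  edge : rel vertex;
  edge_sym : symmetric edge;
  edge_irr : irreflexive edge }.

Definition giso (G H : sgraph) : Prop :=
  exists2 h : G -> H, bijective h & forall x y, edge (h x) (h y) = edge x y.

Definition null_graph : sgraph :=
  @SGraph void (fun _ _ => false) (fun _ _ => erefl) (fun _ => erefl).

Section Induced.
Variables (G : sgraph) (S : {set G}).
Definition induced_edge : rel {x : G | x \in S} :=
  fun x y => edge (val x) (val y).
Lemma induced_sym : symmetric induced_edge.
Proof. by move=> x y; apply: edge_sym. Qed.
Lemma induced_irr : irreflexive induced_edge.
Proof. by move=> x; apply: edge_irr. Qed.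
Definition induced : sgraph := SGraph induced_sym induced_irr.
End Induced.

Section DisjointUnion.
Variables G H : sgraph.
Definition dunion_edge : rel (G + H)%type := fun u v =>
  match u, v with
  | inl x, inl y => edge x y
  | inr x, inr y => edge x y
  | _, _ => false
  end.
Lemma dunion_sym : symmetric dunion_edge.
Proof. by move=> [x|x] [y|y] //=; apply: edge_sym. Qed.
Lemma dunion_irr : irreflexive dunion_edge.
Proof. by move=> [x|x] /=; apply: edge_irr. Qed.
Definition dunion : sgraph := SGraph dunion_sym dunion_irr.
End DisjointUnion.

Record graph_property (P : sgraph -> Prop) : Prop := GraphProperty {
  gp_iso : forall G H : sgraph, giso G H -> P G -> P H;
  gp_null : P null_graph;
  gp_some : exists2 G : sgraph, 0 < #|G| & P G;
  gp_not_all : exists2 G : sgraph, 0 < #|G| & ~ P G }.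

Definition additive (P : sgraph -> Prop) : Prop :=
  forall G H : sgraph, P G -> P H -> P (dunion G H).

Definition induced_hereditary (P : sgraph -> Prop) : Prop :=
  forall (G : sgraph) (S : {set G}), P G -> P (induced S).

(* Either colour class may be empty. *)
Definition colouring (P Q : sgraph -> Prop) (G : sgraph) (A B : {set G}) :
    Prop :=
  [/\ A :|: B = [set: G], A :&: B = set0, P (induced A) & Q (induced B)].

Definition gproduct (P Q : sgraph -> Prop) : sgraph -> Prop :=
  fun G => exists A B : {set G}, colouring P Q A B.

Variant move := MoveLeft | Stay | MoveRight.

(* A tape symbol is the blank [None], an input letter [Some (inl a)] or an
   auxiliary work letter [Some (inr b)]. *)
Definition tsym (Sigma Work : finType) := option (Sigma + Work).

(* The transition function has a finite domain, so it is a finite table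
   whatever Rocq function is used to give it. *)
Record machine (Sigma : finType) := Machine {
  state : finType;
  work : finType;
  ntapes : nat; (* the machine has [ntapes.+1] tapes *)
  start : state;
  halting : pred state;
  delta : state -> {ffun 'I_ntapes.+1 -> tsym Sigma work} ->
          state * {ffun 'I_ntapes.+1 -> tsym Sigma work * move} }.

(* Tapes are infinite to the right only; at cell 0, moving left has no
   effect. *)
Record tape (Gamma : Type) := Tape { cells : nat -> Gamma; head_pos : nat }.

Definition tape_read (Gamma : Type) (t : tape Gamma) : Gamma :=
  cells t (head_pos t).

Definition tape_act (Gamma : Type) (a : Gamma * move) (t : tape Gamma) :
    tape Gamma :=
  Tape [eta cells t with head_pos t |-> a.1]
       match a.2 with
       | MoveLeft => (head_pos t).-1
       | Stay => head_pos t
       | MoveRight => (head_pos t).+1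
       end.

Section Runs.
Variables (Sigma : finType) (M : machine Sigma).

Local Notation sym := (tsym Sigma (work M)).

Record config := Config {
  cstate : state M;
  ctapes : 'I_(ntapes M).+1 -> tape sym }.

Definition step (c : config) : config :=
  if halting (cstate c) then c else
  let r := delta (cstate c) [ffun i => tape_read (ctapes c i)] in
  Config r.1 (fun i => tape_act (r.2 i) (ctapes c i)).

Definition word_cells (w : seq Sigma) : nat -> sym :=
  fun j => nth None [seq Some (inl a) | a <- w] j.

Definition init (w : seq Sigma) : config :=
  Config (start M)
    (fun i => Tape (word_cells (if i == ord0 then w else [::])) 0).

(* Input is on the first tape, output on the last one; the final positions of
   the heads and the contents of the other tapes are irrelevant. *)
Definition outputs_within (w : seq Sigma) (n : nat) (v : seq Sigma) : Prop :=
  let c := iter n step (init w) in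
  halting (cstate c) /\ cells (ctapes c ord_max) =1 word_cells v.
End Runs.

Definition poly_time (Sigma : finType) (I J : Type)
    (encI : I -> seq Sigma) (encJ : J -> seq Sigma) (f : I -> J) : Prop :=
  exists (M : machine Sigma) (c d : nat), forall x : I,
    outputs_within M (encI x) (c * size (encI x) ^ d + c) (encJ (f x)).

(* The instances are the graphs, presented by their adjacency matrix: the
   entries are listed row by row as letters [Some b], each row being followed
   by the end-of-row letter [None]. The order of the vertices is that of
   [enum], which is arbitrary since [vertex] is an arbitrary finite type. *)
Definition encode (G : sgraph) : seq (option bool) :=
  flatten [seq rcons [seq Some (edge x y) | y <- enum G] None | x <- enum G].

(* The transformation maps instances to instances, i.e. graphs to graphs; words
   that encode no graph are not instances. *)
Definition poly_transforms (P Q : sgraph -> Prop) : Prop :=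
  exists2 f : sgraph -> sgraph,
    poly_time encode encode f & forall G : sgraph, P G <-> Q (f G).

(* Main.v *)
(* Write C for the product of A and B. Call a colouring of the vertices of a
   graph H free if, in any number of disjoint copies of H, the edges between
   differently coloured vertices can be redrawn at will without leaving C, and
   call H in C strict if adding one suitable vertex to H leaves C. Let n be the
   largest number of colours such that every strict graph has a free colouring
   with exactly n colours, and let H be strict with a free n-colouring but no
   free (n+1)-colouring. By a Ramsey argument some graph W made of copies of H
   is such that every free n-colouring of a graph containing W coincides, on
   one of these copies, with the given colouring of H. Likewise, every (A,B)-
   colouring of W uses on some copy a set I of colours for A and its complement
   J for B, and I can be kept fixed when H grows, provided that H is chosen with
   as few possibilities for I as possible.
   Given G, join every vertex of G to the same vertices of W, with colours in
   J, chosen by means of the vertex that cannot be added to H. If G is in A, the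
   result is in C, since G has no edges to the A-part of W. Conversely, if the
   result is in C then it is strict, hence has a free n-colouring, and this
   colouring agrees with that of H on some copy. Strictness of H forbids the
   colours in J on G, so that the colouring extends the one of H to the disjoint
   union of G and H; by the choice of H, the colours in I then induce a graph in
   A, and G is an induced subgraph of it.
   W is fixed, so the adjacency matrix of the new graph is obtained by inserting
   a fixed word into each row of the matrix of G and appending a fixed number of
   rows, which takes linear time. *)

Require Import Defs.
From Stdlib Require Import Classical.
From HB Require Import structures.
From mathcomp Require Import all_boot zify.

Set Implicit Arguments.
Unset Strict Implicit.
Unset Printing Implicit Defensive.

(** * Embeddings and two-class colourings *)

Lemma hereditary_embed (P : sgraph -> Prop) (G H : sgraph) (h : G -> H) :
    graph_property P -> induced_hereditary P -> injective h ->
    (forall x y, edge (h x) (h y) = edge x y) -> P H -> P G.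
Proof.
move=> Pprop Pher h_inj hE /(Pher _ [set h x | x in G]).
apply: (gp_iso Pprop).
have im x : h x \in [set h x | x in G] by apply: imset_f.
have im' (y : {y : H | y \in [set h x | x in G]}) : exists x, h x == val y.
  by case: y => y /= /imsetP[x _ ->]; exists x.
exists (fun y => xchoose (im' y)).
  exists (fun x => exist _ (h x) (im x)) => [y|x].
    by apply: val_inj; apply/eqP; apply: xchooseP (im' y).
  by apply: h_inj; apply/eqP; apply: xchooseP (im' _).
by move=> y z; rewrite -hE (eqP (xchooseP (im' y))) (eqP (xchooseP (im' z))).
Qed.

Lemma induced_embed (P : sgraph -> Prop) (G H : sgraph) (S : {set H})
    (h : G -> H) :
    graph_property P -> induced_hereditary P -> injective h ->
    (forall x y, edge (h x) (h y) = edge x y) -> (forall x, h x \in S) ->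
  P (induced S) -> P G.
Proof.
move=> Pprop Pher h_inj hE hS.
apply: (hereditary_embed (h := fun x => exist _ (h x) (hS x) : induced S)) => //.
by move=> x y [/h_inj].
Qed.

Lemma empty_in (P : sgraph -> Prop) (G : sgraph) :
  graph_property P -> (G -> False) -> P G.
Proof.
move=> Pprop G0; apply: (gp_iso Pprop) (gp_null Pprop).
exists (fun x : void => match x with end) => [|[]].
by exists (fun x => False_rect _ (G0 x)) => [[]|x]; case: (G0 x).
Qed.

Lemma colouringP (P Q : sgraph -> Prop) (G : sgraph) :
  gproduct P Q G <->
  exists s : pred G, P (induced [set x | s x]) /\ Q (induced [set x | ~~ s x]).
Proof.
split=> [[X [Y [XY XY0 PX QY]]]|[s [Ps Qs]]].
  exists (mem X); have -> : [set x | mem X x] = X by apply/setP=> x; rewrite inE.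
  suff -> : [set x | ~~ mem X x] = Y by [].
  apply/setP=> x; rewrite inE /=.
  move/setP/(_ x): XY; move/setP/(_ x): XY0; rewrite !inE.
  by case: (x \in X); case: (x \in Y).
exists [set x | s x], [set x | ~~ s x]; split=> //.
  by apply/setP=> x; rewrite !inE orbN.
by apply/setP=> x; rewrite !inE andbN.
Qed.

(** * Joins, overlays and free colourings *)

Section Join.
Variables (G W : sgraph) (D : {set W}).

Definition join_edge : rel (G + W)%type := fun u v =>
  match u, v with
  | inl x, inl y => edge x y
  | inr x, inr y => edge x y
  | inl _, inr y => y \in D
  | inr x, inl _ => x \in D
  end.
Lemma join_sym : symmetric join_edge.
Proof. by move=> [x|x] [y|y] //=; apply: edge_sym. Qed.
Lemma join_irr : irreflexive join_edge.
Proof. by move=> [x|x] /=; apply: edge_irr. Qed.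

Definition join : sgraph := SGraph join_sym join_irr.
End Join.

Definition single_graph : sgraph :=
  @SGraph unit (fun _ _ => false) (fun _ _ => erefl) (fun _ => erefl).

(* [K] is made of pieces of copies of [H], indexed by [T], in which only the
   edges between differently coloured vertices have been redrawn at will. *)
Definition overlay (H K : sgraph) (Q T : eqType) (c : H -> Q)
    (h : K -> H) (a : K -> T) : Prop :=
  injective (fun u => (h u, a u)) /\
  forall u w, c (h u) = c (h w) ->
    edge u w = (a u == a w) && edge (h u) (h w).

Definition free_on (P : sgraph -> Prop) (H : sgraph) (Q : eqType) (c : H -> Q)
    (D : pred H) : Prop :=
  forall (K : sgraph) (T : finType) (h : K -> H) (a : K -> T),
    overlay c h a -> (forall u, D (h u)) -> P K.

Definition free (P : sgraph -> Prop) (H : sgraph) (Q : eqType) (c : H -> Q) :=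
  free_on P c predT.

(** Composing with [j] turns an overlay of [H] into one of [H']. Along [j], [c'] may be finer than
    [c], since only edges within its classes are constrained. *)
Lemma free_on_pull (P : sgraph -> Prop) (H H' : sgraph) (Q Q' : eqType)
    (c : H -> Q) (c' : H' -> Q') (D : pred H) (D' : pred H') (j : H -> H') :
    injective j ->
    (forall x y, c' (j x) = c' (j y) ->
       c x = c y /\ edge (j x) (j y) = edge x y) ->
    (forall x, D x -> D' (j x)) ->
  free_on P c' D' -> free_on P c D.
Proof.
move=> j_inj jE jD free' K T h a [ha_inj hE] hD.
apply: (free' K T (j \o h) a) => [|u]; last exact: jD.
split=> [u w [/j_inj hh aa]|u w /= /jE[cc ->]]; last exact: hE.
by apply: ha_inj; rewrite hh aa.
Qed.

Lemma free_self (P : sgraph -> Prop) (H : sgraph) (Q : eqType) (c : H -> Q) :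
  free P c -> P H.
Proof.
by move/(_ H unit id (fun=> tt)); apply=> //; split=> [x y []|].
Qed.

(** With a single colour no edge can be redrawn, so an overlay embeds in a disjoint union of copies
    of [H], added here one index at a time. *)
Lemma additive_free (P : sgraph -> Prop) (H : sgraph) (Q : eqType) (q : Q) :
    graph_property P -> additive P -> induced_hereditary P ->
  P H -> free P (fun _ : H => q).
Proof.
move=> Pprop Padd Pher PH K T h a [ha_inj /(_ _ _ erefl) hE] _.
suff PS (t : seq T) : P (induced [set u | a u \in t]).
  apply: (induced_embed (h := id) Pprop Pher) (PS (enum T)) => // u.
  by rewrite inE mem_enum.
elim: t => [|x t IHt].
  by apply: empty_in => // -[u]; rewrite inE.
have PU := Padd _ _ PH IHt.
pose S := [set u | a u \in x :: t].
pose g (u : induced S) : dunion H (induced [set u | a u \in t]) :=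
  if insub (val u) is Some v then inr v else inl (h (val u)).
have gP (u : induced S) :
    (a (val u) = x /\ g u = inl (h (val u)) /\ x \notin t) \/
    (exists v, val v = val u /\ g u = inr v).
  rewrite /g; case: insubP => [v uv vE|ut]; first by right; exists v.
  left; case: u ut => u /=; rewrite !inE => /orP[/eqP->//|uS]; last by rewrite uS.
have PtN u : x \notin t -> a u = x -> forall v : induced [set u | a u \in t],
    (a u == a (val v)) = false.
  move=> xt -> [v /=]; rewrite inE => vt; apply: contraNF xt => /eqP->.
  by [].
apply: (hereditary_embed (h := g) Pprop Pher) PU => u w.
  case: (gP u) => [[ux [-> _]]|[u' [uE ->]]];
  case: (gP w) => [[wx [-> _]]|[w' [wE ->]]] // [].
    by move=> huw; apply: val_inj; apply: ha_inj; rewrite huw ux wx.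
  by move=> uw; apply: val_inj; rewrite -uE -wE uw.
rewrite [RHS]/= /induced_edge hE.
case: (gP u) => [[ux [-> xt]]|[u' [uE ->]]];
  case: (gP w) => [[wx [-> xt']]|[w' [wE ->]]] /=.
- by rewrite ux wx eqxx.
- by rewrite -wE PtN.
- by rewrite -uE eq_sym PtN.
- by rewrite /induced_edge uE wE hE.
Qed.

(** * Systems of copies and a Ramsey theorem *)

Section Systems.
Variables (H : sgraph) (Q : finType) (c : H -> Q).

(* An overlay consisting of whole, unaltered copies of [H]. *)
Record system := System {
  index : finType;
  index0 : index;
  sys_edge : rel (H * index)%type;
  sys_sym : symmetric sys_edge;
  sys_copy : forall x y a, sys_edge (x, a) (y, a) = edge x y;
  sys_cross : forall x y a b, a != b -> c x = c y ->
    sys_edge (x, a) (y, b) = false }.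

Lemma sys_irr (M : system) : irreflexive (@sys_edge M).
Proof. by move=> [x a]; rewrite sys_copy edge_irr. Qed.

Definition sys_graph (M : system) : sgraph :=
  SGraph (@sys_sym M) (@sys_irr M).

Lemma sys_overlay (M : system) : @overlay H (sys_graph M) _ _ c fst snd.
Proof.
split=> [[x a] [y b] //|[x a] [y b] /= cE].
by have [->|/sys_cross->] := eqVneq a b; rewrite ?sys_copy.
Qed.

(* Adding the colour of a vertex to the index of its copy ensures that
   differently coloured vertices come from different copies. *)
Lemma sys_embed (K : sgraph) (T : finType) (h : K -> H) (a : K -> T) :
    injective (fun u => (h u, a u)) ->
  exists (M : system) (g : K -> sys_graph M), [/\ injective g,
    forall u, (g u).1 = h u &
    forall u w, (c (h u) = c (h w) ->
                 edge u w = (a u == a w) && edge (h u) (h w)) ->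
      edge (g u) (g w) = edge u w].
Proof.
move=> ha_inj; pose I := option (T * Q).
pose e (u : K) : I := Some (a u, c (h u)); pose g u := (h u, e u).
have g_inj : injective g.
  by move=> u w [hh aa _]; apply: ha_inj; rewrite hh aa.
pose E : rel (H * I)%type := fun p q =>
  if p.2 == q.2 then edge p.1 q.1 else (c p.1 != c q.1) &&
  [exists u, exists w, [&& g u == p, g w == q & edge u w]].
have E_sym : symmetric E.
  move=> p q; rewrite /E eq_sym; case: ifP => _; first exact: edge_sym.
  rewrite eq_sym; congr (_ && _).
  by apply/existsP/existsP => -[u /existsP[w /and3P[gu gw uw]]];
    exists w; apply/existsP; exists u; rewrite gu gw edge_sym.
have E_copy x y i : E (x, i) (y, i) = edge x y by rewrite /E eqxx.
have E_cross x y i j : i != j -> c x = c y -> E (x, i) (y, j) = false.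
  by rewrite /E /= => /negbTE-> ->; rewrite eqxx.
exists (System None E_sym E_copy E_cross), g; split=> // u w uwE.
rewrite /= /E /= -[e u == e w]/((a u == a w) && (c (h u) == c (h w))).
have [/uwE->|cN] /= := eqVneq (c (h u)) (c (h w)).
  by rewrite andbT; case: eqP.
rewrite andbF; apply/existsP/idP => [[u' /existsP[w']]|uw].
  by case/and3P=> /eqP/g_inj-> /eqP/g_inj->.
by exists u; apply/existsP; exists w; rewrite !eqxx.
Qed.

Section SystemProduct.
Variables L M : system.

(** A lexicographic product: each index of [L] carries a slice that is a copy of [M], and every
    transversal [a |-> (a, f a)] is a copy of [L]. *)
Definition prod_edge : rel (H * (index L * index M))%type := fun p q =>
  if p.2.1 == q.2.1 then sys_edge (p.1, p.2.2) (q.1, q.2.2)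
  else sys_edge (p.1, p.2.1) (q.1, q.2.1).

Fact prod_sym : symmetric prod_edge.
Proof.
by move=> p q; rewrite /prod_edge eq_sym; case: ifP => _; apply: sys_sym.
Qed.

Fact prod_copy x y a : prod_edge (x, a) (y, a) = edge x y.
Proof. by rewrite /prod_edge eqxx sys_copy. Qed.

Fact prod_cross x y a b : a != b -> c x = c y ->
  prod_edge (x, a) (y, b) = false.
Proof.
case: a b => [a a'] [b b']; rewrite /prod_edge /= xpair_eqE.
by have [_|ab] := eqVneq a b => /= ab' cxy; rewrite sys_cross.
Qed.

Definition sys_prod := System (index0 L, index0 M) prod_sym prod_copy prod_cross.
End SystemProduct.

Fact unit_cross (x y : H) (a b : unit) : a != b -> c x = c y ->
  edge x y = false.
Proof. by case: a b => [] []. Qed.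

Definition sys_unit : system :=
  @System unit tt (fun p q => edge p.1 q.1) (fun p q => edge_sym p.1 q.1)
    (fun _ _ _ => erefl) unit_cross.

(* A vertex-Ramsey theorem: the vertices being coloured are the copies of [H],
   and the colour of a copy is the pattern that [s] induces on it. *)
Lemma sys_ramsey (R : finType) (Phi : {ffun H -> R} -> system -> Prop) :
  exists M : system, forall s : H * index M -> R,
  (exists t, forall L, ~ Phi [ffun x => s (x, t)] L) \/
  (exists p L (e : index L -> index M), [/\ Phi p L, injective e,
     forall x y a b, sys_edge (x, e a) (y, e b) = sys_edge (x, a) (y, b) &
     forall x a, s (x, e a) = p x]).
Proof.
pose good (M : system) (s : H * index M -> R) (l : seq {ffun H -> R}) :=
  exists t, [ffun x => s (x, t)] \in l -> forall L, ~ Phi [ffun x => s (x, t)] L.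
pose mono (M : system) (s : H * index M -> R) :=
  exists p L (e : index L -> index M), [/\ Phi p L, injective e,
     forall x y a b, sys_edge (x, e a) (y, e b) = sys_edge (x, a) (y, b) &
     forall x a, s (x, e a) = p x].
(* Induction on the list [l] of patterns treated so far: a good copy has a pattern that is outside
   [l] or satisfies [Phi] with no system. *)
suff /(_ (enum {ffun H -> R}))[M MP] (l : seq {ffun H -> R}) :
    exists M : system, forall s : H * index M -> R, good M s l \/ mono M s.
  exists M => s; have [[t tP]|] := MP s; last by right.
  by left; exists t; apply: tP; rewrite mem_enum.
elim: l => [|p l [M MP]].
  by exists sys_unit => s; left; exists tt.
have [[L PhiL]|noL] := classic (exists L, Phi p L); last first.
  exists M => s; have [[t tP]|] := MP s; last by right.
  left; exists t; rewrite inE => /orP[/eqP tp L PhiL|/tP //].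
  by apply: noL; exists L; rewrite -tp.
(* Unless some slice is already monochromatic, each slice [a] has a good copy [f a]. If all of these
   have pattern [p], they form a monochromatic [L]; otherwise one of them is good for [p :: l]. *)
exists (sys_prod L M) => s.
pose slice a (q : H * index M) := s (q.1, (a, q.2)).
have [[a [p' [L' [e [PhiL' e_inj eE sE]]]]]|nomono] :=
    classic (exists a, mono M (slice a)).
  right; exists p', L', (fun b => (a, e b)); split=> // [b b' [/e_inj //]|].
  by move=> x y b b'; rewrite -eE /= /prod_edge /= eqxx.
have /fin_all_exists[f fP] a : exists b,
    [ffun x => s (x, (a, b))] \in l -> forall L, ~ Phi [ffun x => s (x, (a, b))] L.
  by have [//|am] := MP (slice a); case: nomono; exists a.
have [/forallP sp|] := boolP [forall a, [ffun x => s (x, (a, f a))] == p].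
  right; exists p, L, (fun a => (a, f a)); split=> // [a b [] //||x a].
    move=> x y a b; rewrite /= /prod_edge /=; case: eqP => // ->.
    by rewrite !sys_copy.
  by rewrite -(eqP (sp a)) ffunE.
rewrite negb_forall => /existsP[a ap]; left; exists (a, f a).
by rewrite inE (negbTE ap) => /fP.
Qed.
End Systems.

(** * Strict graphs in the product *)

Section Product.
Variables A B : sgraph -> Prop.
Hypotheses (A_prop : graph_property A) (A_add : additive A)
  (A_her : induced_hereditary A).
Hypotheses (B_prop : graph_property B) (B_add : additive B)
  (B_her : induced_hereditary B).

Local Notation C := (gproduct A B).

Lemma product_embed (G H : sgraph) (h : G -> H) : injective h ->
  (forall x y, edge (h x) (h y) = edge x y) -> C H -> C G.
Proof.
move=> h_inj hE /colouringP[s [As Bs]]; apply/colouringP; exists (s \o h).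
split.
- apply: (induced_embed (h := fun x : induced [set x | s (h x)] => h (val x))
    A_prop A_her) As.
  + by move=> x y /h_inj /val_inj.
  + by move=> x y; apply: hE.
  + by move=> [x /=]; rewrite !inE.
- apply: (induced_embed (h := fun x : induced [set x | ~~ s (h x)] => h (val x))
    B_prop B_her) Bs.
  + by move=> x y /h_inj /val_inj.
  + by move=> x y; apply: hE.
  + by move=> [x /=]; rewrite !inE.
Qed.

(** Substitute a graph [E] outside [B] for each vertex of a graph [F] outside [A]. Either every
    fibre meets the [A]-class, which then contains a copy of [F], or some fibre is a copy of [E] in
    the [B]-class. *)
Lemma product_proper : exists F : sgraph, ~ C F.
Proof.
have [[F _ AF] [E _ BE]] := (gp_not_all A_prop, gp_not_all B_prop).
pose e : rel (F * E)%type :=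
  fun u v => if u.1 == v.1 then edge u.2 v.2 else edge u.1 v.1.
have e_sym : symmetric e.
  by move=> u v; rewrite /e eq_sym; case: ifP => _; apply: edge_sym.
have e_irr : irreflexive e by move=> u; rewrite /e eqxx edge_irr.
exists (SGraph e_sym e_irr) => /colouringP[s [As Bs]].
have [/forallP sP|] := boolP [forall x, exists y, s (x, y)].
  have /fin_all_exists[f sf] x : exists y, s (x, y) by apply/existsP/sP.
  apply: AF; apply: (induced_embed (h := fun x => (x, f x) : SGraph e_sym e_irr)
    A_prop A_her) As.
  - by move=> x y [].
  - by move=> x y /=; rewrite /e /=; case: eqP => // ->; rewrite !edge_irr.
  - by move=> x; rewrite inE.
rewrite negb_forall => /existsP[x]; rewrite negb_exists => /forallP nsP.
apply: BE; apply: (induced_embed (h := fun y => (x, y) : SGraph e_sym e_irr)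
  B_prop B_her) Bs.
- by move=> y z [].
- by move=> y z /=; rewrite /e /= eqxx.
- by move=> y; rewrite inE.
Qed.

Definition strict_at (H : sgraph) (N : {set H}) : Prop :=
  C H /\ ~ C (join single_graph N).

Definition strict (H : sgraph) : Prop := exists N : {set H}, strict_at N.

(** Delete a vertex from a smallest graph outside [C]; its neighbourhood is the witness. *)
Lemma strict_exists : exists H : sgraph, strict H.
Proof.
have [F0 CF0] := product_proper.
have [F [CF Fmin]] : exists F : sgraph, ~ C F /\
    forall G : sgraph, #|G| < #|F| -> C G.
  have [n] := ubnP #|F0|; elim: n F0 CF0 => // n IHn F CF /ltnSE leFn.
  have [Fmin|nFmin] := classic (forall G : sgraph, #|G| < #|F| -> C G).
    by exists F.
  have [G nG] := not_all_ex_not _ _ nFmin.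
  have [ltGF CG] := imply_to_and _ _ nG.
  by apply: (IHn G CG); apply: leq_trans ltGF leFn.
have [v|Fnull] := pickP F; last first.
  case: CF; apply/colouringP; exists xpredT.
  by split; apply: empty_in => // x; have := Fnull (val x).
pose H := induced [set~ v]; exists H, [set x : H | edge v (val x)]; split.
  apply: Fmin; rewrite [#|H|]card_sig -[#|F|]cardsT (cardsD1 v [set: F]) inE add1n ltnS.
  by apply/subset_leq_card/subsetP=> x; rewrite !inE andbT.
move=> CJ; apply: CF; move: CJ.
pose h (x : F) : join single_graph [set x : H | edge v (val x)] :=
  if insub x is Some y then inr y else inl tt.
have hP x : (x = v /\ h x = inl tt) \/ (exists y : H, val y = x /\ h x = inr y).
  rewrite /h; case: insubP => [y xv yE|]; first by right; exists y.
  by rewrite !inE negbK => /eqP->; left.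
apply: (product_embed (h := h)).
  move=> x y.
  by case: (hP x) => [[-> ->]|[x' [<- ->]]]; case: (hP y) => [[-> ->]|[y' [<- ->]]] // [->].
move=> x y.
case: (hP x) => [[-> ->]|[x' [<- ->]]]; case: (hP y) => [[-> ->]|[y' [<- ->]]] //=.
- by rewrite edge_irr.
- by rewrite inE.
- by rewrite inE edge_sym.
Qed.

Lemma strict_extend (H K : sgraph) (e : H -> K) : injective e ->
  (forall x y, edge (e x) (e y) = edge x y) -> strict H -> C K -> strict K.
Proof.
move=> e_inj eE [N [_ CN]] CK; exists [set e x | x in N]; split=> // CJ.
apply: CN; apply: (product_embed (h := fun u : join single_graph N =>
  match u with inl z => inl z | inr x => inr (e x) end
  : join single_graph [set e x | x in N])) CJ.
  by move=> [x|x] [y|y] // [] // => [-> //|/e_inj->].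
by move=> [x|x] [y|y] //=; rewrite mem_imset.
Qed.

(** If [v] had the adjacencies of [N] within its own colour class, freeness would allow the other
    edges at [v] to be redrawn, putting the forbidden extension of [H] in [C]. *)
Lemma strict_separates (H K : sgraph) (N : {set H}) (e : H -> K) (Q : eqType)
    (c : K -> Q) (v : K) : strict_at N -> injective e ->
    (forall x y, edge (e x) (e y) = edge x y) -> free C c ->
    (forall x, e x != v) ->
  ~ (forall x, c (e x) = c v -> edge v (e x) = (x \in N)).
Proof.
move=> [_ CN] e_inj eE c_free ev vN; apply: CN.
pose j (u : join single_graph N) := if u is inr x then e x else v.
apply: (@free_self C _ _ (c \o j)).
apply: (free_on_pull (j := j) (D' := predT)) c_free => //.
  move=> [[]|x] [[]|y] //= => [ve|ev'|/e_inj-> //].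
    by have := ev y; rewrite ve eqxx.
  by have := ev x; rewrite ev' eqxx.
move=> [[]|x] [[]|y] //= cE; split=> //.
- by rewrite edge_irr.
- by rewrite vN.
- by rewrite edge_sym vN.
Qed.

(** For a colour missing on the copy of [H], the condition excluded by [strict_separates] would hold
    vacuously. *)
Lemma strict_meets (H K : sgraph) (e : H -> K) (Q : eqType) (c : K -> Q) :
    strict H -> injective e -> (forall x y, edge (e x) (e y) = edge x y) ->
    free C c ->
  forall v, exists x, c (e x) = c v.
Proof.
move=> [N HN] e_inj eE c_free v.
have [/existsP[x /eqP xv]|] := boolP [exists x, c (e x) == c v]; first by exists x.
rewrite negb_exists => /forallP ncv.
case: (strict_separates HN e_inj eE c_free (v := v)) => x.
  by apply: contraNneq (ncv x) => ->.
by move/eqP; rewrite (negbTE (ncv x)).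
Qed.

(** * Free colourings with as many colours as possible *)

Definition surj (X Y : Type) (f : X -> Y) := forall y, exists x, f x = y.

Lemma free_const (H : sgraph) (Q : eqType) (q : Q) :
  C H -> free C (fun _ : H => q).
Proof.
move=> /colouringP[s [As Bs]] K T h a [ha_inj /(_ _ _ erefl) hE] _.
apply/colouringP; exists (s \o h).
have free_half (P : sgraph -> Prop) (S : {set H}) : graph_property P ->
    additive P -> induced_hereditary P -> P (induced S) ->
    P (induced [set u | h u \in S]).
  move=> Pprop Padd Pher PS.
  have hS (u : induced [set u | h u \in S]) : h (val u) \in S.
    by case: u => u /=; rewrite inE.
  have PSfree := additive_free (q := tt) Pprop Padd Pher PS.
  apply: (PSfree (induced [set u | h u \in S]) T
    (fun u => exist _ (h (val u)) (hS u) : induced S) (a \o val)) => //.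
  split=> [u w [hh aa]|u w _]; last exact: hE.
  by apply: val_inj; apply: ha_inj; rewrite /= hh aa.
have half (b : bool -> bool) :
    [set u | b ((s \o h) u)] = [set u | h u \in [set x | b (s x)]].
  by apply/setP=> u; rewrite !inE.
by split; [rewrite (half id)|rewrite (half negb)]; apply: free_half.
Qed.

Lemma strict_nonempty (H : sgraph) : strict H -> exists x : H, true.
Proof.
move=> [N [_ CN]]; have [x|H0] := pickP H; first by exists x.
have [G G_gt0 AG] := gp_some A_prop.
have [v _|] := pickP G; last by move/eq_card0=> G0; rewrite G0 in G_gt0.
case: CN.
apply: (product_embed (H := G) (h := fun=> v)).
- by move=> [[]|x]; last (by have := H0 x); move=> [[]|y] //; have := H0 y.
- move=> [x|x]; last by have := H0 x.
  by move=> [y|y]; last (by have := H0 y); rewrite edge_irr.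
apply/colouringP; exists xpredT; split.
  by apply: (hereditary_embed (H := G)
    (h := fun x : induced [set x : G | xpredT x] => val x)
    A_prop A_her val_inj) AG.
by apply: empty_in => // -[x]; rewrite inE.
Qed.

Definition splits (n : nat) : Prop := forall H, strict H ->
  exists2 c : H -> 'I_n, surj c & free C c.

Definition tight (n : nat) (H : sgraph) (c : H -> 'I_n) : Prop :=
  [/\ strict H, surj c, free C c &
      forall c' : H -> 'I_n.+1, surj c' -> ~ free C c'].

(** Constant colourings give [splits 1], and surjective colourings cannot use more colours than a
    strict graph has vertices, so [splits] fails right after some [n]. *)
Lemma tight_exists : exists n,
  splits n /\ exists (H : sgraph) (c : H -> 'I_n), tight c.
Proof.
have [H0 H0s] := strict_exists.
have splits1 : splits 1.
  move=> H Hs; exists (fun=> ord0); last by apply: free_const; case: Hs => ? [].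
  by have [x _] := strict_nonempty Hs; move=> i; exists x; rewrite [i]ord1.
have [n [n_gt0 sn nsn]] : exists n, [/\ 0 < n, splits n & ~ splits n.+1].
  apply: NNPP => nex.
  have sall n : splits n.+1.
    elim: n => // n IHn; apply: NNPP => nsn.
    by apply: nex; exists n.+1.
  have [c c_surj _] := sall #|H0| H0 H0s.
  have /fin_all_exists[g gK] := c_surj.
  have /leq_card : injective g by apply: can_inj gK.
  by rewrite card_ord ltnn.
exists n; split=> //.
have [H nH] := not_all_ex_not _ _ nsn.
have [Hs nc] := imply_to_and _ _ nH.
have [c c_surj c_free] := sn H Hs.
exists H, c; split=> // c' c'_surj c'_free.
by apply: nc; exists c'.
Qed.

(** If [p] separated [x] from [y] in one class of [c], the part of [x] could become an extra colour
    while [y] keeps the old one, contradicting tightness. *)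
Lemma tight_refine (n : nat) (H : sgraph) (c : H -> 'I_n) (R : eqType)
    (p : H -> R) : tight c -> free C (fun x => (c x, p x)) ->
  forall x y, c x = c y -> p x = p y.
Proof.
move=> [_ c_surj _ c_max] cp_free x y cxy; apply/eqP/negPn/negP => pxy.
pose c' z : 'I_n.+1 :=
  if (c z == c x) && (p z == p x) then ord_max else widen_ord (leqnSn n) (c z).
apply: (c_max c'); last first.
  apply: (free_on_pull (j := id)) cp_free => // u w [cuw puw].
  by rewrite /c' cuw puw.
move=> i; have [lt_in|] := ltnP i n; last first.
  rewrite leq_eqVlt [n < i]ltnNge -ltnS ltn_ord orbF => /eqP ni.
  by exists x; rewrite /c' !eqxx; apply: val_inj.
have [z zi] := c_surj (Ordinal lt_in).
have [cp|cp] := boolP ((c z == c x) && (p z == p x)).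
  exists y; rewrite /c' -cxy eqxx eq_sym (negbTE pxy) /=; apply: val_inj.
  by case/andP: cp => /eqP<- _; rewrite zi.
by exists z; rewrite /c' (negbTE cp); apply: val_inj; rewrite /= zi.
Qed.

Definition good (n : nat) (H : sgraph) (c : H -> 'I_n) (I : {set 'I_n}) :
    Prop :=
  free_on A c (fun x => c x \in I) /\ free_on B c (fun x => c x \notin I).

Lemma good_exists (n : nat) (H : sgraph) (c : H -> 'I_n) :
  tight c -> exists I, good c I.
Proof.
move=> tc; have [_ c_surj c_free _] := tc.
(* [Phi p L] says that [L] contains, up to edges between the two halves of [p], an overlay refuting
   one half. On a monochromatic [L] this contradicts the colouring [s]. *)
pose Phi (p : {ffun H -> bool}) (L : system c) :=
  exists (K : sgraph) (g : K -> sys_graph L),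
  [/\ injective g,
      forall u w : K, p (g u).1 = p (g w).1 ->
        @edge (sys_graph L) (g u) (g w) = edge u w &
      (~ A K /\ forall u, p (g u).1) \/ (~ B K /\ forall u, ~~ p (g u).1)].
have [M MP] := sys_ramsey Phi.
have /colouringP[s [As Bs]] : C (sys_graph M).
  exact: (c_free (sys_graph M) (index M) fst snd (sys_overlay M)).
have [[t noPhi]|[p [L [e [[K [g [g_inj gE gP]]] e_inj eE sE]]]]] := MP s; last first.
  pose j (u : K) : sys_graph M := ((g u).1, e (g u).2).
  have j_inj : injective j.
    move=> u w [guw1 /e_inj guw2]; apply: g_inj.
    by rewrite [g u]surjective_pairing [g w]surjective_pairing guw1 guw2.
  have jE u w : p (g u).1 = p (g w).1 -> edge (j u) (j w) = edge u w.
    by move=> /gE<-; rewrite /= eE -!surjective_pairing.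
  case: gP => [[AK pT]|[BK pF]].
    case: AK; apply: (induced_embed (h := j) A_prop A_her j_inj) As => [u w|u].
      by rewrite jE // !pT.
    by rewrite inE sE pT.
  case: BK; apply: (induced_embed (h := j) B_prop B_her j_inj) Bs => [u w|u].
    by rewrite jE // (negbTE (pF u)) (negbTE (pF w)).
  by rewrite inE sE pF.
pose p := [ffun x => s (x, t)].
have noK (b : bool) (P : sgraph -> Prop) :
    (forall (L : system c) (K : sgraph) (g : K -> sys_graph L), injective g ->
       (forall u w : K, p (g u).1 = p (g w).1 ->
          @edge (sys_graph L) (g u) (g w) = edge u w) ->
       ~ P K -> (forall u, p (g u).1 = b) -> Phi p L) ->
    free_on P c (fun x => p x == b).
  move=> mkPhi K T h a [ha_inj hE] pb; apply: NNPP => PK.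
  have [L [g [g_inj gh gE]]] := sys_embed c ha_inj.
  apply: (noPhi L); apply: (mkPhi L K g) => // [u w _|u].
    by apply: gE; apply: hE.
  by rewrite gh; apply/eqP.
have Afree : free_on A c (fun x => p x == true).
  apply: noK => L K g g_inj gE AK pT; exists K, g; split=> //.
  by left; split.
have Bfree : free_on B c (fun x => p x == false).
  apply: noK => L K g g_inj gE BK pF; exists K, g; split=> //.
  by right; split=> // u; rewrite pF.
(* Freeness of both halves makes the refinement of [c] by [p] free for [C], so by tightness the
   halves are unions of colour classes. *)
have pc : forall x y, c x = c y -> p x = p y.
  apply: (tight_refine tc) => K T h a [ha_inj hE] _.
  apply/colouringP; exists (fun u => p (h u)); split.
    have pv (u : induced [set u | p (h u)]) : p (h (val u)).
      by have := valP u; rewrite inE.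
    apply: (Afree _ T (fun u : induced [set u | p (h u)] => h (val u)) (a \o val)).
      split=> [u w [hh aa]|u w cc]; first by apply/val_inj/ha_inj; rewrite hh aa.
      by apply: hE; rewrite cc !pv.
    by move=> u; apply/eqP/pv.
  have pv (u : induced [set u | ~~ p (h u)]) : p (h (val u)) = false.
    by apply/negbTE; have := valP u; rewrite inE.
  apply: (Bfree _ T (fun u : induced [set u | ~~ p (h u)] => h (val u)) (a \o val)).
    split=> [u w [hh aa]|u w cc]; first by apply/val_inj/ha_inj; rewrite hh aa.
    by apply: hE; rewrite cc !pv.
  by move=> u; apply/eqP/pv.
exists [set c x | x in [pred x | p x]].
have pI x : (c x \in [set c x | x in [pred x | p x]]) = p x.
  apply/imsetP/idP => [[y py /pc->] //|px]; by exists x.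
by split; [move: Afree|move: Bfree]; move=> Pfree K T h a ov hD;
  apply: (Pfree K T h a ov) => u; have := hD u; rewrite pI; case: (p _).
Qed.

(** Good sets survive restriction to [H], so a tight extension creates no new ones. Each failure of
    stability loses one, and there are finitely many. *)
Lemma stable_exists (n : nat) (H : sgraph) (c : H -> 'I_n) : tight c ->
  exists (H' : sgraph) (c' : H' -> 'I_n), tight c' /\
  forall (K : sgraph) (d : K -> 'I_n) (e : H' -> K), tight d -> injective e ->
    (forall x y, edge (e x) (e y) = edge x y) -> d \o e =1 c' ->
  forall I, good c' I -> good d I.
Proof.
pose allgood (H : sgraph) (c : H -> 'I_n) (S : {set {set 'I_n}}) :=
  forall I, good c I -> I \in S.
have [S] : exists S : {set {set 'I_n}}, allgood H c S.
  by exists setT => I; rewrite inE.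
have [m] := ubnP #|S|; elim: m S H c => // m IHm S H c /ltnSE leSm cS tc.
have [st|nst] := classic (forall (K : sgraph) (d : K -> 'I_n) (e : H -> K),
    tight d -> injective e -> (forall x y, edge (e x) (e y) = edge x y) ->
    d \o e =1 c -> forall I, good c I -> good d I).
  by exists H, c.
have [K [d [e [td e_inj eE de [I [cI dI]]]]]] :
    exists (K : sgraph) (d : K -> 'I_n) (e : H -> K), [/\ tight d, injective e,
      forall x y, edge (e x) (e y) = edge x y, d \o e =1 c &
      exists I, good c I /\ ~ good d I].
  apply: NNPP => nex; apply: nst => K d e td e_inj eE de I cI.
  by apply: NNPP => dI; apply: nex; exists K, d, e; split=> //; exists I.
have goodS J : good d J -> good c J.
  have pull P (D : pred 'I_n) : free_on P d (D \o d) -> free_on P c (D \o c).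
    apply: (free_on_pull (j := e) e_inj) => [x y|x /=].
      by rewrite -!de /= eE.
    by rewrite -de.
  move=> [Ad Bd]; split.
    exact: (pull A (mem J)).
  exact: (pull B (fun i => i \notin J)).
apply: (IHm (S :\ I) K d) => //.
  by apply: leq_trans leSm; rewrite (cardsD1 I S) (cS I cI).
move=> J dJ; rewrite !inE cS ?andbT; last exact: goodS.
by apply: contra_not_neq dI => <-.
Qed.

(** A pattern not constant on the classes of [c] has, by [tight_refine], an overlay outside [C]. A
    system containing it cannot be monochromatic in that pattern under a free colouring. *)
Lemma tight_ramsey (n : nat) (H : sgraph) (c : H -> 'I_n) (R : finType) :
    tight c ->
  exists M : system c, forall s : sys_graph M -> R, free C s ->
  exists t, forall x y, c x = c y -> s (x, t) = s (y, t).
Proof.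
move=> tc.
pose Phi (p : {ffun H -> R}) (L : system c) :=
  exists (K : sgraph) (g : K -> sys_graph L),
  [/\ injective g, forall u w : K, p (g u).1 = p (g w).1 ->
        @edge (sys_graph L) (g u) (g w) = edge u w & ~ C K].
have [M MP] := sys_ramsey Phi; exists M => s s_free.
have [[t noPhi]|[p [L [e [[K [g [g_inj gE CK]]] e_inj eE sE]]]]] := MP s; last first.
  pose j (u : K) : sys_graph M := ((g u).1, e (g u).2).
  case: CK; apply: (@free_self C K _ (s \o j)).
  apply: (free_on_pull (j := j)) s_free => //.
    move=> u w [guw1 /e_inj guw2]; apply: g_inj.
    by rewrite [g u]surjective_pairing [g w]surjective_pairing guw1 guw2.
  move=> u w suw; split=> //; rewrite -gE.
    by rewrite /= eE -!surjective_pairing.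
  by move: suw; rewrite /j /= !sE.
exists t => x y cxy.
suff : [ffun x => s (x, t)] x = [ffun x => s (x, t)] y by rewrite !ffunE.
apply: (tight_refine tc) cxy => K T h a [ha_inj hE] _; apply: NNPP => CK.
have [L [g [g_inj gh gE]]] := sys_embed c ha_inj.
apply: (noPhi L); exists K, g; split=> // u w.
rewrite !gh => pp; apply: gE => cc.
by apply: hE; rewrite cc pp.
Qed.

(** * The joining construction and its correctness *)

Lemma surj_inj (T : finType) (f : T -> T) : surj f -> injective f.
Proof.
move=> /fin_all_exists[g gK]; have [k kg gk] := injF_bij (can_inj gK).
by move=> x y fxy; rewrite -[x]gk -[y]gk -[k x]gK -[k y]gK !gk fxy.
Qed.

Theorem join_reduction : exists (W : sgraph) (D : {set W}),
  forall G : sgraph, A G <-> C (join G D).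
Proof.
have [n [n_splits [H0 [c0 /stable_exists[H [c [tc stable]]]]]]] := tight_exists.
have [I Igood] := good_exists tc.
have [[N HN] c_surj c_free c_max] := tc.
have [M MP] := tight_ramsey 'I_n tc.
have [ov_inj ovE] := sys_overlay M.
(* All copies are joined alike, since the copy on which a later colouring agrees with [c] is not
   known beforehand. *)
pose D : {set sys_graph M} := [set q | (q.1 \in N) && (c q.1 \notin I)].
exists (sys_graph M), D => G; split=> [AG|CJ].
  pose s (u : join G D) := if u is inr q then c q.1 \in I else true.
  have [Ifree Jfree] := Igood.
  apply/colouringP; exists s; split.
    pose S := [set q : sys_graph M | c q.1 \in I].
    have AS : A (induced S).
      apply: (Ifree (induced S) (index M) (fun q => (val q).1) (fun q => (val q).2)).
        by split=> [q r /ov_inj/val_inj //|q r /ovE].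
      by move=> q; have := valP q; rewrite inE.
    have sS q : s (inr q) -> q \in S by rewrite inE.
    have us (u : induced [set u | s u]) : s (val u) by have := valP u; rewrite inE.
    pose g0 (u : join G D) : s u -> dunion G (induced S) :=
      match u with
      | inl v => fun _ => inl v
      | inr q => fun sq => inr (exist _ q (sS q sq))
      end.
    apply: (hereditary_embed (h := fun u : induced [set u | s u] => g0 (val u) (us u))
      A_prop A_her)
      (A_add AG AS).
      case=> -[v|q] up; case=> -[w|r] wp //= [E]; apply: val_inj; rewrite /= ?E //.
    case=> -[v|q] up; case=> -[w|r] wp //=; rewrite /induced_edge /= inE.
      by move: wp; rewrite !inE /= => ->; rewrite andbF.
    by move: up; rewrite !inE /= => ->; rewrite andbF.
  have us (u : induced [set u | ~~ s u]) : ~~ s (val u) by have := valP u; rewrite inE.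
  have no_inl v : inl v \in [set u | ~~ s u] -> False by rewrite inE.
  pose g0 (u : join G D) : ~~ s u -> H * index M :=
    match u with
    | inl v => fun ns => False_rect _ (notF ns)
    | inr q => fun _ => q
    end.
  apply: (Jfree (induced [set u | ~~ s u]) (index M)
    (fun u : induced _ => (g0 (val u) (us u)).1)
    (fun u => (g0 (val u) (us u)).2)).
    split.
      move=> [[v|q] up]; first by case: (no_inl v up).
      move=> [[v|r] wp]; first by case: (no_inl v wp).
      by move/ov_inj => /= qr; apply: val_inj; rewrite /= qr.
    move=> [[v|q] up]; first by case: (no_inl v up).
    move=> [[v|r] wp]; first by case: (no_inl v wp).
    by move/ovE.
  by move=> u; move: (us u); case: (val u).
have G'_copy t : injective (fun x => inr (x, t) : join G D) /\
    forall x y, @edge (join G D) (inr (x, t)) (inr (y, t)) = edge x y.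
  by split=> [x y []|x y] //=; apply: sys_copy.
have G's : strict (join G D).
  have [e_inj eE] := G'_copy (index0 M).
  by apply: (strict_extend e_inj eE) => //; exists N.
have [d d_surj d_free] := n_splits _ G's.
have [t ct] : exists t, forall x y, c x = c y -> d (inr (x, t)) = d (inr (y, t)).
  apply: (MP (fun q => d (inr q))).
  by apply: (free_on_pull (j := fun q => inr q : join G D)) d_free => // x y [].
have [e_inj eE] := G'_copy t.
have d_meets v : exists x, d (inr (x, t)) = d v.
  by apply: (strict_meets _ e_inj eE d_free v); exists N.
(* On copy [t], [d] factors through [c] and takes all [n] values; a surjection between [n] colours
   is injective, so both have the same classes. *)
have dc x y : d (inr (x, t)) = d (inr (y, t)) -> c x = c y.
  have /fin_all_exists[g gK] := c_surj.
  pose f i := d (inr (g i, t)).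
  have f_surj : surj f.
    move=> i; have [v <-] := d_surj i; have [z <-] := d_meets v.
    by exists (c z); apply: ct; rewrite gK.
  move=> dxy; apply: (surj_inj f_surj).
  by rewrite /f (ct _ x (gK _)) (ct _ y (gK _)).
have /fin_all_exists[l lP] v := d_meets (inl v).
(* Outside [I], the vertex [v] would be joined to its own class exactly as [N] prescribes, against
   [strict_separates]. *)
have lI v : c (l v) \in I.
  apply/negPn/negP => lI.
  case: (strict_separates (K := join G D) (v := inl v) HN e_inj eE d_free) => // x.
  by rewrite -lP => /dc cx; rewrite /= inE /= cx lI andbT.
pose U := dunion G H.
pose c2 (u : U) := match u with inl v => c (l v) | inr x => c x end.
pose j (u : U) : join G D := match u with inl v => inl v | inr x => inr (x, t) end.
pose w (u : U) := match u with inl v => l v | inr x => x end.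
have dj u : d (j u) = d (inr (w u, t)) by case: u => //= v; rewrite lP.
have c2w u : c2 u = c (w u) by case: u.
(* [G] has no edges to the [I]-coloured vertices, so within colour classes [U] agrees with the image
   of [j]. *)
have c2_free : free C c2.
  apply: (free_on_pull (j := j)) d_free => //.
    by move=> [v|x] [v'|x'] //= [->].
  move=> u u'; rewrite !dj => /dc cc; split; first by rewrite !c2w.
  case: u u' cc => [v|x] [v'|x'] //= cc.
  - by rewrite inE /= -cc lI andbF.
  - by rewrite inE /= cc lI andbF.
  - exact: sys_copy.
have inr_inj : injective (inr : H -> U) by move=> x y [].
have Us : strict U.
  by apply: (strict_extend inr_inj) => //; [exists N|exact: free_self c2_free].
have tc2 : tight c2.
  (* A free colouring of [U] with one more colour would stay surjective on [H] by [strict_meets]. *)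
  split=> // [i|c' c'_surj c'_free].
    by have [x <-] := c_surj i; exists (inr x).
  apply: (c_max (c' \o inr)) => [i|].
    have [u <-] := c'_surj i.
    by apply: (strict_meets _ inr_inj _ c'_free u) => //; exists N.
  by apply: (free_on_pull (j := inr : H -> U)) c'_free.
have [Afree _] := stable U c2 inr tc2 inr_inj (fun _ _ => erefl) (fun _ => erefl) I Igood.
apply: (Afree G unit (fun v => inl v) (fun=> tt)) => //.
by split=> [v v' []|].
Qed.
End Product.

(** * Two-way transducers with one marker *)

Section Transducer.
Variables (Sigma Q : finType) (q0 : Q) (stop : pred Q) (m : nat).

Local Notation sym := (tsym Sigma unit).

(* From a control state and the scanned symbol: the next state, whether to
   overwrite the symbol with the marker, the move, and the word to output. *)
Variable act : Q -> sym -> Q * bool * move * seq Sigma.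
Hypothesis size_act : forall q a, size (act q a).2 <= m.

Definition marker : sym := Some (inr tt).

(* The words of output are written one letter at a time, the rest of the
   current one being kept in the state. *)
Definition transducer : machine Sigma :=
  @Machine Sigma (Q * m.-bseq Sigma)%type unit 1 (q0, [bseq])
    (fun x => stop x.1 && nilp x.2)
    (fun x r =>
       if (x.2 : seq Sigma) is b :: u then
         ((x.1, insub_bseq m u),
          [ffun i => if i == ord0 then (r i, Stay)
                     else (Some (inl b), MoveRight)])
       else
         let: (q, mark, mv, u) := act x.1 (r ord0) in
         ((q, insub_bseq m u),
          [ffun i => if i == ord0 then (if mark then marker else r i, mv)
                     else (r i, Stay)])).

Definition tconf := (Q * seq sym * nat * seq Sigma)%type.

Definition tstep (x : tconf) : tconf :=
  let: (q, s, p, o) := x in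
  if stop q then x else
  let: (q', mark, mv, u) := act q (nth None s p) in
  (q', if mark then set_nth None s p marker else s,
   match mv with MoveLeft => p.-1 | Stay => p | MoveRight => p.+1 end, o ++ u).

(** [u] is the output still pending in the state, not yet part of [o]. *)
Definition simulates (c : config transducer) (x : tconf) (u : seq Sigma) :
    Prop :=
  let: (q, s, p, o) := x in
  [/\ (cstate c).1 = q, ((cstate c).2 : seq Sigma) = u &
  [/\ cells (ctapes c ord0) =1 nth None s, head_pos (ctapes c ord0) = p,
      cells (ctapes c ord_max) =1 word_cells transducer o &
      head_pos (ctapes c ord_max) = size o]].

Lemma word_cells_rcons (o : seq Sigma) b :
  [eta word_cells transducer o with size o |-> Some (inl b)] =1
  word_cells transducer (rcons o b).
Proof.
move=> j; rewrite /word_cells /= map_rcons nth_rcons size_map.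
by case: ltngtP => // lt_oj; rewrite nth_default // size_map ltnW.
Qed.

Lemma insub_bseqK (u : seq Sigma) : size u <= m -> insub_bseq m u = u :> seq _.
Proof. by move=> um; rewrite /insub_bseq insubdK. Qed.

Lemma simulates_letter c q s p o b u : simulates c (q, s, p, o) (b :: u) ->
  simulates (step c) (q, s, p, rcons o b) u.
Proof.
case: c => [[q' v] t] [/= -> vE [s0 p0 o1 p1]].
have um : size u <= m by have := size_bseq v; rewrite vE; apply: leq_trans.
rewrite /step /= vE andbF /= insub_bseqK //.
split=> //; split=> [j|||].
- rewrite /= !ffunE /=; case: eqP => [->|_]; last exact: s0.
  by rewrite /tape_read s0.
- by rewrite ffunE /=.
- move=> j; rewrite -word_cells_rcons /= !ffunE /= p1.
  by case: eqP => // _; apply: o1.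
- by rewrite !ffunE /= p1 size_rcons.
Qed.

Lemma simulates_flush c q s p o u : simulates c (q, s, p, o) u ->
  simulates (iter (size u) (@step _ transducer) c) (q, s, p, o ++ u) [::].
Proof.
elim: u c o => [|b u IHu] c o cE; first by rewrite cats0.
rewrite [size _]/= iterSr -cat_rcons; exact/IHu/simulates_letter.
Qed.

Lemma simulates_step c q s p o q' mark mv u :
    act q (nth None s p) = (q', mark, mv, u) -> ~~ stop q ->
    simulates c (q, s, p, o) [::] ->
  simulates (step c) (q', if mark then set_nth None s p marker else s,
   match mv with MoveLeft => p.-1 | Stay => p | MoveRight => p.+1 end, o) u.
Proof.
case: c => [[q1 v] t] actE nq [/= qE vE [s0 p0 o1 p1]].
have um : size u <= m by have := size_act q (nth None s p); rewrite actE.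
rewrite /step /= qE (negbTE nq) /= vE !ffunE /tape_read p0 s0 actE /=.
split=> //; first by rewrite insub_bseqK.
split=> [j|||].
- rewrite /= ffunE /= !ffunE /= /tape_read p0 s0.
  by case: mark {actE}; rewrite /= ?nth_set_nth /=; case: eqP => // ->.
- by rewrite !ffunE.
- move=> j; rewrite /= !ffunE /=; case: eqP => [->|_]; last exact: o1.
  by rewrite /tape_read o1.
- by rewrite !ffunE /= p1.
Qed.

(** Each abstract step costs one machine step and at most [m] more to write its output. *)
Lemma simulates_run c x k : simulates c x [::] ->
  exists2 n, n <= k * m.+1 &
    simulates (iter n (@step _ transducer) c) (iter k tstep x) [::].
Proof.
elim: k c x => [|k IHk] c [[[q s] p] o] cx; first by exists 0.
rewrite iterSr [tstep _]/=; case: ifP => [qs|/negbT nq].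
  by have [n nk nE] := IHk c _ cx; exists n => //; rewrite mulSn (leq_trans nk) ?leq_addl.
case actE: (act q _) => [[[q' mark] mv] u].
have /simulates_flush c'E := simulates_step actE nq cx.
have [n nk nE] := IHk _ _ c'E; exists (n + (size u).+1).
  have := size_act q (nth None s p); rewrite actE /= => um.
  by rewrite mulSn addnC leq_add.
by rewrite iterD iterSr.
Qed.

Lemma transducer_outputs (w v : seq Sigma) (k n : nat) q s p :
    iter k tstep (q0, [seq Some (inl a) | a <- w], 0, [::]) = (q, s, p, v) ->
    stop q -> k * m.+1 <= n ->
  outputs_within transducer w n v.
Proof.
move=> kE qs kn.
have init_sim : simulates (init transducer w)
  (q0, [seq Some (inl a) | a <- w], 0, [::]) [::] by split.
have [l lk] := simulates_run k init_sim; rewrite kE.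
set c := iter l _ _ => -[qE uE [_ _ vE _]].
have c_halt : halting (cstate c) by rewrite /= qE qs uE.
have stuck i : iter i (@step _ transducer) c = c.
  by elim: i => //= i ->; rewrite /step c_halt.
by rewrite /outputs_within -(subnK (leq_trans lk kn)) iterD stuck.
Qed.
End Transducer.

(** * Appending rows and columns in linear time *)

Section Append.
Variables (Sigma : finType) (sep : Sigma).
Variables (alpha : seq Sigma) (rows : seq (Sigma * seq Sigma)).

(* If [w] is an adjacency matrix whose rows end with [sep], this appends the
   columns [alpha ... alpha] and, for [(b, r)] in [rows], the row [b ... b r]. *)
Definition append_rows (w : seq Sigma) : seq Sigma :=
  flatten [seq if a == sep then rcons alpha sep else [:: a] | a <- w] ++
  flatten [seq nseq (count_mem sep w) r.1 ++ rcons r.2 sep | r <- rows].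

Local Notation J := 'I_(size rows).+1.

(* [Rewind j] moves back to the marker, and [Sweep j] produces line [j]. *)
Variant phase := Start | Copy | Rewind of J | Sweep of J.

Definition phase_code (q : phase) : option (option (J + J)) :=
  match q with
  | Start => None
  | Copy => Some None
  | Rewind j => Some (Some (inl j))
  | Sweep j => Some (Some (inr j))
  end.
Definition phase_decode (x : option (option (J + J))) : phase :=
  match x with
  | None => Start
  | Some None => Copy
  | Some (Some (inl j)) => Rewind j
  | Some (Some (inr j)) => Sweep j
  end.
Fact phase_codeK : cancel phase_code phase_decode.
Proof. by case. Qed.
HB.instance Definition _ := Finite.copy phase (can_type phase_codeK).

Definition row (j : nat) := nth (sep, [::]) rows j.

(** The marker replaces the first letter, output beforehand, so that rewinding can detect the left
    end. Index [size rows] means that no line is left. *)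
Definition append_act (q : phase) (a : tsym Sigma unit) :
    phase * bool * move * seq Sigma :=
  match q with
  | Start => if a is Some (inl b) then (Copy, true, MoveRight, [:: b])
             else (Rewind ord0, true, Stay, [::])
  | Copy => if a is Some (inl b) then
              (Copy, false, MoveRight,
               if b == sep then rcons alpha sep else [:: b])
            else (Rewind ord0, false, MoveLeft, [::])
  | Rewind j => if a is Some (inr _) then (Sweep j, false, MoveRight, [::])
                else (Rewind j, false, MoveLeft, [::])
  | Sweep j => if a is Some (inl b) then
                 (Sweep j, false, MoveRight,
                  if b == sep then [:: (row j).1] else [::])
               else (Rewind (inord j.+1), false, MoveLeft,
                     rcons (row j).2 sep)
  end.

Definition append_stop (q : phase) : bool :=
  if q is Rewind j then j == size rows :> nat else false.

Definition append_max : nat :=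
  maxn (size alpha).+1 (\max_(r <- rows) (size r.2).+1).

Lemma size_append_act q a : size (append_act q a).2 <= append_max.
Proof.
have max_gt0 : 0 < append_max by rewrite leq_max.
have row_max j : size (rcons (row j).2 sep) <= append_max.
  rewrite size_rcons; have [lt_j|ge_j] := ltnP j (size rows).
    rewrite leq_max; apply/orP; right.
    by apply: (leq_bigmax_seq (F := fun r => (size r.2).+1)); rewrite ?mem_nth.
  by rewrite /row nth_default.
case: q => [||j|j]; case: a => [[b|[]]|] //=; case: ifP => // _.
by rewrite size_rcons leq_maxl.
Qed.

Local Notation tstep := (tstep append_stop append_act).

Definition reaches (k : nat) (x y : tconf Sigma phase) :=
  exists2 i, i <= k & iter i tstep x = y.

Lemma reaches_trans k l x y z :
  reaches k x y -> reaches l y z -> reaches (k + l) x z.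
Proof.
move=> [i ik <-] [j jl <-]; exists (j + i); first by rewrite addnC leq_add.
by rewrite iterD.
Qed.

Lemma reaches_le k l x y : k <= l -> reaches k x y -> reaches l x y.
Proof. by move=> kl [i ik <-]; exists i => //; apply: leq_trans kl. Qed.

Lemma reaches_step x : reaches 1 x (tstep x).
Proof. by exists 1. Qed.

Lemma reaches_refl k x : reaches k x x.
Proof. by exists 0. Qed.

Section Run.
Variable w : seq Sigma.

(** Here [w] is the input without its overwritten first letter, so letter [i] is in cell [i.+1]. *)
Let s : seq (tsym Sigma unit) := marker Sigma :: [seq Some (inl b) | b <- w].

Lemma nth_tape w1 b w2 : w = w1 ++ b :: w2 ->
  nth None [seq (Some (inl b) : tsym Sigma unit) | b <- w] (size w1) =
  Some (inl b).
Proof. by move=> ->; rewrite map_cat nth_cat size_map ltnn subnn. Qed.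

Lemma nth_tape_end :
  nth None [seq (Some (inl b) : tsym Sigma unit) | b <- w] (size w) = None.
Proof. by rewrite nth_default ?size_map. Qed.

Lemma copy_run w1 w2 o : w = w1 ++ w2 ->
  reaches (size w2) (Copy, s, (size w1).+1, o)
    (Copy, s, (size w).+1,
     o ++ flatten [seq if b == sep then rcons alpha sep else [:: b] | b <- w2]).
Proof.
elim: w2 w1 o => [|b w2 IHw] w1 o wE.
  by rewrite wE !cats0; apply: reaches_refl.
rewrite [size _]/= -add1n; apply: reaches_trans (reaches_step _) _.
rewrite [tstep _]/= (nth_tape wE) /= catA -(size_rcons w1 b).
by apply: IHw; rewrite cat_rcons.
Qed.

Lemma sweep_run j w1 w2 o : w = w1 ++ w2 ->
  reaches (size w2) (Sweep j, s, (size w1).+1, o)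
    (Sweep j, s, (size w).+1, o ++ nseq (count_mem sep w2) (row j).1).
Proof.
elim: w2 w1 o => [|b w2 IHw] w1 o wE.
  by rewrite wE !cats0; apply: reaches_refl.
rewrite [size _]/= -add1n; apply: reaches_trans (reaches_step _) _.
rewrite [tstep _]/= (nth_tape wE) /= nseqD catA -(size_rcons w1 b).
have -> : (if b == sep then [:: (row j).1] else [::]) = nseq (b == sep) (row j).1.
  by case: ifP.
by apply: IHw; rewrite cat_rcons.
Qed.

Lemma rewind_run (j : J) p o : j < size rows -> p <= (size w).+1 ->
  reaches p.+1 (Rewind j, s, p, o) (Sweep j, s, 1, o).
Proof.
move=> lt_j; elim: p => [|p IHp] ps.
  suff <- : tstep (Rewind j, s, 0, o) = (Sweep j, s, 1, o) by apply: reaches_step.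
  by rewrite /= ltn_eqF // cats0.
rewrite -[p.+2]add1n; apply: (reaches_trans (reaches_step _)).
suff -> : tstep (Rewind j, s, p.+1, o) = (Rewind j, s, p, o) by apply: IHp (ltnW ps).
have [lt_p|le_p] := ltnP p (size w).
  by rewrite /= ltn_eqF // (nth_map sep) //= cats0.
by rewrite /= ltn_eqF // nth_default ?size_map //= cats0.
Qed.

Lemma line_run (j : J) p o : j < size rows -> p <= (size w).+1 ->
  reaches (2 * (size w).+2) (Rewind j, s, p, o)
    (Rewind (inord j.+1), s, size w,
     o ++ nseq (count_mem sep w) (row j).1 ++ rcons (row j).2 sep).
Proof.
move=> lt_j ps; rewrite mul2n -addnn.
apply: (reaches_trans (reaches_le _ (rewind_run o lt_j ps))) => //.
apply: (@reaches_le (size w + 1)); first by rewrite addn1.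
apply: reaches_trans (sweep_run j o (erefl : w = [::] ++ w)) _.
exists 1; rewrite // [LHS]/= nth_tape_end /= -catA //.
Qed.

Lemma lines_run k (j : J) p o : j + k = size rows -> p <= (size w).+1 ->
  exists p', reaches (k * (2 * (size w).+2)) (Rewind j, s, p, o)
    (Rewind ord_max, s, p', o ++ flatten
       [seq nseq (count_mem sep w) r.1 ++ rcons r.2 sep | r <- drop j rows]).
Proof.
elim: k j p o => [|k IHk] j p o jk ps.
  rewrite addn0 in jk; have -> : j = ord_max by apply: val_inj.
  by exists p; rewrite drop_size cats0; apply: reaches_refl.
have lt_j : j < size rows by rewrite -[X in _ < X]jk -addSnnS leq_addr.
have jS : (inord j.+1 : J) = j.+1 :> nat by rewrite inordK.
have [p' run'] := IHk (inord j.+1) (size w)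
  (o ++ nseq (count_mem sep w) (row j).1 ++ rcons (row j).2 sep)
  (etrans (congr1 (addn^~ k) jS) (etrans (addSnnS j k) jk)) (leqnSn _).
exists p'; rewrite (drop_nth (sep, [::]) lt_j) /= catA mulSn.
by apply: reaches_trans (line_run o lt_j ps) _; rewrite jS in run'.
Qed.
End Run.

(** One pass copies, and two passes produce each new line. The sweeps miss the overwritten first
    letter, so it must not be a separator. *)
Lemma append_run (w : seq Sigma) : head sep w != sep \/ w = [::] ->
  exists s p, reaches ((size rows).*2.+2 * (size w).+2)
    (Start, [seq Some (inl b) | b <- w], 0, [::])
    (Rewind ord_max, s, p, append_rows w).
Proof.
case: w => [|a w] wP.
  have [p run] := @lines_run [::] (size rows) ord0 0 [::] (add0n _) isT.
  exists [:: marker Sigma], p; rewrite drop0 in run.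
  have := reaches_trans (reaches_step (Start, [::], 0, [::])) run.
  case=> i ik iE; exists i => //; apply: leq_trans ik _.
  by rewrite /= -muln2; lia.
have aN : a == sep = false by case: wP => // /negbTE.
have [p run] := @lines_run w (size rows) ord0 (size w) 
  ([:: a] ++ flatten [seq if b == sep then rcons alpha sep else [:: b] | b <- w])
  (add0n _) (leqnSn _).
exists (marker Sigma :: [seq Some (inl b) | b <- w]), p.
rewrite drop0 in run.
have run1 : reaches 1 (Copy, marker Sigma :: [seq Some (inl b) | b <- w],
    (size w).+1, [:: a] ++ flatten [seq if b == sep then rcons alpha sep else [:: b] | b <- w])
  (Rewind ord0, marker Sigma :: [seq Some (inl b) | b <- w], size w,
   [:: a] ++ flatten [seq if b == sep then rcons alpha sep else [:: b] | b <- w]).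
  by exists 1; rewrite // [LHS]/= nth_tape_end /= cats0.
have := reaches_trans
  (reaches_step (Start, [seq Some (inl b) | b <- a :: w], 0, [::]))
  (reaches_trans (copy_run [:: a] (erefl : w = [::] ++ w))
  (reaches_trans run1 run)).
case=> i ik iE; exists i; first by apply: leq_trans ik _; rewrite /= -muln2; lia.
by rewrite iE /append_rows /= aN add0n -catA.
Qed.

Lemma append_poly_time (I Y : Type) (encI : I -> seq Sigma)
    (encY : Y -> seq Sigma) (f : I -> Y) :
    (forall x, head sep (encI x) != sep \/ encI x = [::]) ->
    (forall x, encY (f x) = append_rows (encI x)) ->
  poly_time encI encY f.
Proof.
move=> encIP fE.
(* The factor 2 absorbs [(size w).+2 <= 2 * (size w).+1]; the last one is the cost of an abstract
   step. *)
pose c := (size rows).*2.+2 * 2 * append_max.+1.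
exists (transducer Start append_stop append_max append_act), c, 1 => x.
have [s [p [k kP kE]]] := append_run (encIP x).
rewrite fE; apply: (transducer_outputs size_append_act kE).
  by rewrite /= eqxx.
apply: leq_trans (leq_mul kP (leqnn _)) _.
rewrite expn1 -mulnSr /c -!mulnA leq_mul2l; apply/orP; right.
by rewrite mulnC mulnCA leq_mul2l; apply/orP; right; lia.
Qed.
End Append.

(** * The adjacency matrix of a join *)

Lemma enum_sum (S T : finType) :
  enum {: S + T} = [seq inl x | x <- enum S] ++ [seq inr y | y <- enum T].
Proof. by rewrite !enumT {1}unlock /= /sum_enum -!enumT. Qed.

Definition join_row (W : sgraph) (D : {set W}) : seq (option bool) :=
  [seq Some (y \in D) | y <- enum W].

Definition join_rows (W : sgraph) (D : {set W}) :
    seq (option bool * seq (option bool)) :=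
  [seq (Some (x \in D), [seq Some (edge x y) | y <- enum W]) | x <- enum W].

Lemma encode_join (G W : sgraph) (D : {set W}) :
  encode (join G D) = append_rows None (join_row D) (join_rows D) (encode G).
Proof.
rewrite /encode /append_rows enum_sum map_cat flatten_cat; congr (_ ++ _).
  rewrite /join_row; move: (enum G) (enum W) => eG eW.
  rewrite -map_comp; elim: {2 4}eG => //= x t ->.
  rewrite [in RHS]map_cat flatten_cat; congr (_ ++ _).
  rewrite map_cat -!map_comp map_rcons flatten_rcons -rcons_cat -map_comp.
  by congr (rcons (_ ++ _) None); elim: eG => //= y t' ->.
have -> : count_mem None (encode G) = #|G|.
  rewrite cardE /encode count_flatten -map_comp.
  elim: {2 3}(enum G) => //= x t ->; rewrite -cats1 count_cat /= count_map.
  by rewrite (eq_count (a2 := pred0)) ?count_pred0.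
rewrite /join_rows cardE; move: (enum G) (enum W) => eG eW.
rewrite -!map_comp; congr (flatten _); apply: eq_map => x /=.
rewrite map_cat -!map_comp rcons_cat; congr (_ ++ _).
by elim: eG => //= y t ->.
Qed.

Lemma head_encode (G : sgraph) :
  head None (encode G) != None \/ encode G = [::].
Proof.
by rewrite /encode; case: (enum G) => [|x t]; [right|left].
Qed.

Theorem theorem1 (A B : sgraph -> Prop)
  (A_prop : graph_property A) (A_add : additive A)
  (A_her : induced_hereditary A)
  (B_prop : graph_property B) (B_add : additive B)
  (B_her : induced_hereditary B) :
  poly_transforms A (gproduct A B).
Proof.
have [W [D AC]] := join_reduction A_prop A_add A_her B_prop B_add B_her.
exists (fun G => join G D) => //.
apply: append_poly_time head_encode _ => G.
exact: encode_join.
Qed.
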